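(* For every $0<\varepsilon\le 1$ there is an online algorithm for the fractional allocation problem on a weighted star with the following guarantee. For every instance with cost vectors $h^1,h^2,\dots$, starting configuration $x^0$ and quota pattern $\kappa=(\kappa(1),\kappa(2),\dots)$, $$\mathrm{Hit}_{\mathrm{ALG}}\le(1+\varepsilon)\big(\mathrm{OPT}+w_{\max}\,g(\kappa)\big)+C,\qquad \mathrm{Mov}_{\mathrm{ALG}}\le O(\log(k/\varepsilon))\cdot\big(\mathrm{OPT}+w_{\max}\,g(\kappa)\big),$$ where $C$ is a quantity depending only on the starting and final configurations of the online algorithm, with $C=0$ if these two configurations coincide.
   Context: Weighted star: locations $1,\dots,d$, location $i$ at distance $w_i>0$ from the center; $w_{\max}=\max_i w_i$. At each time $t$ a quota $\kappa(t)\le k$ (a nonnegative integer) is given and a cost vector $h^t=(h^t(0),\dots,h^t(k))$ with $h^t(0)\ge h^t(1)\ge\dots\ge h^t(k)\ge 0$ arrives at a location $i_t$ ($h^t(j)$ is the cost of serving the request with exactly $j$ servers at $i_t$). A fractional state is $x^t=(x^t_{i,j})_{i\in[d],\,0\le j\le k}$ with $x^t_{i,j}\ge0$, $\sum_j x^t_{i,j}=1$ for each $i$, and $\sum_i\sum_j j\,x^t_{i,j}\le\kappa(t)$. An online algorithm chooses $x^t$ after seeing $\kappa(t),h^t,i_t$ (and the past). Hit cost at time $t$: $\sum_j h^t(j)x^t_{i_t,j}$; movement cost at time $t$: $\sum_i w_i\sum_{j=1}^k\big|\sum_{j'<j}x^t_{i,j'}-\sum_{j'<j}x^{t-1}_{i,j'}\big|$.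 $\mathrm{Hit}_{\mathrm{ALG}}$ and $\mathrm{Mov}_{\mathrm{ALG}}$ are the total hit and movement costs of the online algorithm. $\mathrm{OPT}$ is the total hit plus movement cost of an optimal integral solution (all $x^t_{i,j}\in\{0,1\}$) starting from the same initial configuration $x^0$, assumed integral. $g(\kappa)=\sum_t|\kappa(t)-\kappa(t-1)|$, with $\kappa(0)$ the initial quota. *)

(* Defs.v *)
From HB Require Import structures.
From mathcomp Require Import all_boot all_order all_algebra.
From mathcomp Require Import all_classical all_reals all_analysis.

Set Implicit Arguments.
Unset Strict Implicit.
Unset Printing Implicit Defensive.

Import Order.TTheory GRing.Theory Num.Theory.
Local Open Scope classical_set_scope.
Local Open Scope ring_scope.

Record star (R : realType) := Star {
  nloc : nat;
  weight : 'I_nloc -> R;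
  weight_gt0 : forall i, 0 < weight i
}.

Definition wmax (R : realType) (S : star R) : R :=
  \big[Num.max/0]_(i < nloc S) weight i.

(* [x i j] is the fraction of "exactly j servers at location i". *)
Definition state (R : realType) (S : star R) (k : nat) : Type :=
  'M[R]_(nloc S, k.+1).

Definition is_state (R : realType) (S : star R) (k : nat) (q : nat)
    (x : state S k) : Prop :=
  [/\ forall i j, 0 <= x i j,
      forall i, \sum_(j < k.+1) x i j = 1 &
      \sum_i \sum_(j < k.+1) (j : nat)%:R * x i j <= q%:R].

Definition integral_state (R : realType) (S : star R) (k : nat)
    (x : state S k) : Prop :=
  forall i j, x i j = 0 \/ x i j = 1.

Record request (R : realType) (S : star R) (k : nat) := Request {
  req_quota : nat;
  req_loc : 'I_(nloc S);
  req_cost : 'I_k.+1 -> R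
}.

(* Requests arrive at times t >= 1: [loc _ 0] and [hcost _ 0] are never used,
   whereas [kappa _ 0] is the initial quota. *)
Record instance (R : realType) (S : star R) (k : nat) := Instance {
  start : state S k;
  kappa : nat -> nat;
  loc : nat -> 'I_(nloc S);
  hcost : nat -> 'I_k.+1 -> R
}.

Definition valid_instance (R : realType) (S : star R) (k : nat)
    (I : instance S k) : Prop :=
  [/\ forall t, (kappa I t <= k)%N,
      forall t, (0 < t)%N ->
        (forall j, 0 <= hcost I t j) /\
        (forall j j' : 'I_k.+1, (j <= j')%N -> hcost I t j' <= hcost I t j),
      is_state (kappa I 0) (start I) &
      integral_state (start I)].

Definition history (R : realType) (S : star R) (k : nat) (I : instance S k)
    (t : nat) : seq (request S k) :=
  [seq Request (kappa I s) (loc I s) (hcost I s) | s <- iota 1 t].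

(* An algorithm is given the star, k, the starting configuration and the
   initial quota; at each time t >= 1 it picks its new state from the requests
   seen so far, the current one included. *)
Definition online_algorithm (R : realType) : Type :=
  forall (S : star R) (k : nat),
    state S k -> nat -> seq (request S k) -> state S k.

Definition run (R : realType) (A : online_algorithm R) (S : star R) (k : nat)
    (I : instance S k) (t : nat) : state S k :=
  if t is 0 then start I else A S k (start I) (kappa I 0) (history I t).

Definition solution (R : realType) (S : star R) (k : nat) (I : instance S k)
    (T : nat) (x : nat -> state S k) : Prop :=
  x 0%N = start I /\
  forall t, (0 < t <= T)%N -> is_state (kappa I t) (x t).

Definition hit (R : realType) (S : star R) (k : nat) (I : instance S k)
    (T : nat) (x : nat -> state S k) : R :=
  \sum_(1 <= t < T.+1) \sum_(j < k.+1) hcost I t j * x t (loc I t) j.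

Definition cumul (R : realType) (S : star R) (k : nat) (x : state S k)
    (i : 'I_(nloc S)) (j : nat) : R :=
  \sum_(j' < k.+1 | (j' < j)%N) x i j'.

Definition move (R : realType) (S : star R) (k : nat) (x y : state S k) : R :=
  \sum_i weight i * \sum_(1 <= j < k.+1) `|cumul y i j - cumul x i j|.

Definition mov (R : realType) (S : star R) (k : nat) (T : nat)
    (x : nat -> state S k) : R :=
  \sum_(1 <= t < T.+1) move (x t.-1) (x t).

(* The infimum is over the nonempty set of costs of the feasible integral
   solutions up to time T; there are finitely many such costs, so it is the
   cost of an optimal integral solution. *)
Definition opt (R : realType) (S : star R) (k : nat) (I : instance S k)
    (T : nat) : R :=
  inf [set c : R | exists y : nat -> state S k,
    [/\ solution I T y,
        forall t, (t <= T)%N -> integral_state (y t) &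
        c = hit I T y + mov T y]].

Definition quota_var (R : realType) (S : star R) (k : nat) (I : instance S k)
    (T : nat) : R :=
  \sum_(1 <= t < T.+1) `|(kappa I t)%:R - (kappa I t.-1)%:R|.

(* Main.v *)
(* The algorithm is mirror descent on the levels z_(i,j) = P(fewer than j
   servers at i): the hit cost is linear in z and the movement is a weighted l1
   distance.  With d = 1/(k+1), a request moves the state to a feasible
   minimizer of ln(1 + 1/d) times the hit cost plus the weighted relative
   entropy of the new shifted levels z + d with respect to the old ones.
   By the three-point identity of the relative entropy, the divergence of the
   offline state from the online one is a potential, which gives Hit <= OPT.
   For the movement the potential is the sum of w y ln((1 + d)/(z + d)) against
   an integral offline solution y.  Its decrease is, up to the hit cost of y,
   the derivative of the proximal objective in direction y.  Optimality of the
   step against a direction in which the raised levels decay while the levels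
   that y saturates grow bounds this derivative below by a third of the upward
   movement; integrality of y makes that direction respect the quota.  The
   potential also dominates half the weighted excess of y over z, so that the
   downward movement is bounded by the upward one with no additive constant. *)

Require Import Defs.
From HB Require Import structures.
From mathcomp Require Import all_boot all_order all_algebra.
From mathcomp Require Import all_classical all_reals all_analysis.
From mathcomp Require Import ring lra.

Set Implicit Arguments.
Unset Strict Implicit.
Unset Printing Implicit Defensive.

Import Order.TTheory GRing.Theory Num.Theory.
Import numFieldNormedType.Exports.
Local Open Scope classical_set_scope.
Local Open Scope ring_scope.

Lemma near_right_affine_gt0 (R : realFieldType) (a b : R) :
  0 < a -> \forall s \near 0^'+, 0 < a + s * b.
Proof.
move=> a_gt0.
have b1_gt0 : 0 < 1 + `|b| by rewrite ltr_pwDl.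
near=> s.
have s_gt0 : 0 < s by near: s; exact: nbhs_right_gt.
have : s * (1 + `|b|) < a.
  by rewrite -ltr_pdivlMr//; near: s; apply: nbhs_right_lt; rewrite divr_gt0.
have : - (s * `|b|) <= s * b.
  by rewrite -mulrN ler_pM2l// lerNl -normrN ler_norm.
lra.
Unshelve. all: by end_near. Qed.

Lemma closed_forall (T : topologicalType) (I : Type) (A : I -> set T) :
  (forall i, closed (A i)) -> closed [set x | forall i, A i x].
Proof.
move=> A_closed; rewrite (_ : mkset _ = \bigcap_i A i).
  exact: closed_bigI.
by apply/seteqP; split=> x xA i; [move=> _|]; exact: xA.
Qed.

Lemma continuous_at_sum (T : topologicalType) (K : numFieldType)
    (V : normedModType K) (I : Type) (r : seq I) (P : pred I) (f : I -> T -> V)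
    (x : T) :
  (forall i, P i -> {for x, continuous (f i)}) ->
  {for x, continuous (fun y => \sum_(i <- r | P i) f i y)}.
Proof. by move=> f_cts; apply: cvg_big => //; exact: add_continuous. Qed.

Lemma mx_linear_continuous (K : numFieldType) (V : normedModType K) (m n : nat)
    (f : {linear 'M[K]_(m, n) -> V}) : continuous f.
Proof.
move=> M.
have -> : f = (fun N => \sum_i \sum_j N i j *: f (delta_mx i j)) :> (_ -> V).
  apply/funext => N; rewrite {1}[N]matrix_sum_delta linear_sum.
  apply: eq_bigr => i _; rewrite linear_sum; apply: eq_bigr => j _.
  exact: linearZ.
apply: continuous_at_sum => i _; apply: continuous_at_sum => j _.
by apply: continuousZ; [exact: coord_continuous|exact: cst_continuous].
Qed.

Lemma mx_compact (K : numFieldType) (m n : nat) (A : set K) :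
  compact A -> compact [set M : 'M[K]_(m, n) | forall i j, A (M i j)].
Proof.
move=> A_compact.
have rows_compact := @rV_compact K (m * n) (fun=> A) (fun=> A_compact).
have vec_mx_cts : continuous (@vec_mx K m n) by exact: mx_linear_continuous.
have := continuous_compact (continuous_subspaceT vec_mx_cts) rows_compact.
congr compact; apply/seteqP; split=> [_ [v vA <-] i j|M MA].
  by rewrite mxE.
exists (mxvec M); last exact: mxvecK.
by move=> l; case/mxvec_indexP: l => i j; rewrite mxvecE.
Qed.

(** * Relative entropy *)

Section RelativeEntropy.
Variable R : realType.
Implicit Types p q r : R.

Lemma subr_le_mul_lnB p q : 0 < p -> 0 < q -> p - q <= p * (ln p - ln q).
Proof.
move=> p_gt0 q_gt0.
have ln_le : ln (q / p) <= q / p - 1.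
  have := @le_ln1Dx R (q / p - 1); rewrite [1 + _]addrC subrK; apply.
  by rewrite ltrBrDr addNr divr_gt0.
have := ler_wpM2l (ltW p_gt0) ln_le.
rewrite ln_div// !mulrBr mulr1 [p * (q / p)]mulrC divfK ?gt_eqF//; lra.
Qed.

Definition rel_entropy p q : R := p * (ln p - ln q) - p + q.

Lemma rel_entropy_ge0 p q : 0 < p -> 0 < q -> 0 <= rel_entropy p q.
Proof.
move=> p_gt0 q_gt0; have := subr_le_mul_lnB p_gt0 q_gt0.
by rewrite /rel_entropy; lra.
Qed.

Lemma rel_entropyxx p : rel_entropy p p = 0.
Proof. by rewrite /rel_entropy subrr mulr0 sub0r addNr. Qed.

Lemma rel_entropy_three_point p q r :
  rel_entropy p q =
  rel_entropy p r + rel_entropy r q + (p - r) * (ln r - ln q).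
Proof. by rewrite /rel_entropy; ring. Qed.

Lemma rel_entropy_le_chi2 p q :
  0 < p -> 0 < q -> rel_entropy p q <= (p - q) ^+ 2 / q.
Proof.
move=> p_gt0 q_gt0; rewrite ler_pdivlMr// /rel_entropy.
have := ler_wpM2l (ltW p_gt0) (subr_le_mul_lnB q_gt0 p_gt0); lra.
Qed.

Lemma rel_entropyB_le p q r : 0 < p -> 0 < r ->
  rel_entropy r q - rel_entropy p q <= (r - p) * (ln r - ln q).
Proof.
move=> p_gt0 r_gt0; rewrite (rel_entropy_three_point p q r).
have := rel_entropy_ge0 p_gt0 r_gt0; lra.
Qed.

End RelativeEntropy.

Section ShiftedLogarithm.
Variables (R : realType) (d : R).
Hypothesis d_gt0 : 0 < d.

(* The length of the interval of values of [ln (u + d)] for [u] in [[0, 1]]. *)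
Definition log_range : R := ln (1 + d^-1).

Lemma log_rangeE : log_range = ln (1 + d) - ln d.
Proof.
rewrite -ln_div ?posrE ?addr_gt0//; congr ln.
by rewrite mulrDl mul1r divff ?gt_eqF// addrC.
Qed.

Lemma log_range_gt0 : 0 < log_range.
Proof. by rewrite ln_gt0// ltrDl invr_gt0. Qed.

Lemma log_range_ge_half : d <= 1 -> 1 / 2 <= log_range.
Proof.
move=> d_le1; rewrite log_rangeE.
have := @subr_le_mul_lnB R (1 + d) d (addr_gt0 ltr01 d_gt0) d_gt0.
have range_ge0 : 0 <= ln (1 + d) - ln d.
  by rewrite subr_ge0 ler_ln ?posrE ?addr_gt0// lerDr.
have := ler_wpM2r range_ge0 d_le1; lra.
Qed.

Lemma ler_lnD (u v : R) : 0 <= u -> u <= v -> ln (u + d) <= ln (v + d).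
Proof.
move=> u_ge0 uv; have v_ge0 := le_trans u_ge0 uv.
by rewrite ler_ln ?posrE ?ltr_wpDl// lerD2r.
Qed.

Lemma ler_norm_lnDB (u v : R) : 0 <= u <= 1 -> 0 <= v <= 1 ->
  `|ln (u + d) - ln (v + d)| <= log_range.
Proof.
have bounds t : 0 <= t <= 1 -> ln d <= ln (t + d) <= ln (1 + d).
  move=> /andP[t_ge0 t_le1]; rewrite -[ln d](congr1 (fun a => ln a) (add0r d)).
  by rewrite !ler_lnD.
by move=> /bounds ? /bounds ?; rewrite log_rangeE ler_norml; lra.
Qed.

Lemma rel_entropyD_lipschitz (y y' z : R) :
  0 <= y <= 1 -> 0 <= y' <= 1 -> 0 <= z <= 1 ->
  rel_entropy (y' + d) (z + d) <=
  rel_entropy (y + d) (z + d) + log_range * `|y' - y|.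
Proof.
move=> y_itv y'_itv z_itv; rewrite -lerBlDl.
apply: le_trans (rel_entropyB_le _ _ _) _.
- by rewrite ltr_wpDl//; case/andP: y_itv.
- by rewrite ltr_wpDl//; case/andP: y'_itv.
rewrite opprD addrACA subrr addr0 mulrC; apply: le_trans (ler_norm _) _.
by rewrite normrM ler_wpM2r// ler_norm_lnDB.
Qed.

Lemma subr_le_mul_ln_deficit (y z : R) : d <= 1 ->
  0 <= y <= 1 -> 0 <= z <= 1 -> y - z <= 2 * (y * (ln (1 + d) - ln (z + d))).
Proof.
move=> d_le1 /andP[y_ge0 y_le1] /andP[z_ge0 z_le1].
have zd_gt0 : 0 < z + d by rewrite ltr_wpDl.
have deficit_ge0 : 0 <= ln (1 + d) - ln (z + d) by rewrite subr_ge0 ler_lnD.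
have := subr_le_mul_lnB (addr_gt0 ltr01 d_gt0) zd_gt0.
have := ler_wpM2r deficit_ge0 d_le1 => d_deficit gap.
have deficit_ge : 1 - z <= 2 * (ln (1 + d) - ln (z + d)) by lra.
have := ler_wpM2l y_ge0 deficit_ge; have := ler_wpM2r z_ge0 y_le1; lra.
Qed.

End ShiftedLogarithm.

(** * Levels of a state *)

Section Levels.
Variables (R : realType) (S : star R) (k : nat).
Implicit Types (x D : state S k) (i : 'I_(nloc S)).
Implicit Types g : 'I_(nloc S) -> nat -> R.
Local Notation page := ('I_(nloc S) * 'I_k)%type.

Lemma cumul0 x i : cumul x i 0 = 0.
Proof. by rewrite /cumul big_pred0. Qed.

Lemma cumulS x i (j : 'I_k.+1) : cumul x i j.+1 = cumul x i j + x i j.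
Proof.
rewrite /cumul (bigD1 j)//= addrC; congr (_ + _); apply: eq_bigl => l.
by rewrite ltnS ltn_neqAle andbC.
Qed.

Lemma cumul_all x i : cumul x i k.+1 = \sum_j x i j.
Proof. by apply: eq_bigl => l; rewrite ltn_ord. Qed.

Definition of_cumul g : state S k := \matrix_(i, j) (g i j.+1 - g i j).

Lemma cumul_of_cumul g i j : (j <= k.+1)%N ->
  cumul (of_cumul g) i j = g i j - g i 0%N.
Proof.
move=> jk; rewrite -telescope_sumr// big_mkord.
rewrite (big_ord_widen _ (fun l => g i l.+1 - g i l) jk).
by apply: eq_bigr => l _; rewrite mxE.
Qed.

(* The probability of having at most [p.2] servers at [p.1]. *)
Definition level (p : page) x : R := cumul x p.1 p.2.+1.

Lemma level_is_linear p : linear (level p).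
Proof.
move=> a x D; rewrite /level /cumul scaler_sumr -big_split /=.
by apply: eq_bigr => j _; rewrite !mxE.
Qed.

HB.instance Definition _ p :=
  GRing.isLinear.Build R (state S k) R _ (level p) (level_is_linear p).

Lemma level_continuous p : continuous (level p).
Proof. exact: mx_linear_continuous. Qed.

Lemma sum_mul_cumul (h : 'I_k.+1 -> R) x i :
  \sum_j h j * x i j = h ord_max * (\sum_j x i j) +
  \sum_(j < k) (h (widen_ord (leqnSn k) j) - h (lift ord0 j)) * cumul x i j.+1.
Proof.
pose cost_drop (l : 'I_k) : R := h (widen_ord (leqnSn k) l) - h (lift ord0 l).
have cost_dropE (j : 'I_k.+1) :
    \sum_(l < k | (j <= l)%N) cost_drop l = h j - h ord_max.
  rewrite -[j in RHS]inord_val -[ord_max]inord_val -opprB.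
  rewrite -(telescope_sumr (fun l => h (inord l)) (leq_ord j)) -sumrN.
  rewrite big_geq_mkord.
  apply: eq_bigr => l _; rewrite opprB; congr (h _ - h _);
    by apply: val_inj; rewrite /= inordK ?ltnS// ltnW.
under [X in _ = _ + X]eq_bigr do rewrite -/(cost_drop _) /cumul mulr_sumr.
rewrite (exchange_big_dep predT)//= mulr_sumr -big_split/=.
by apply: eq_bigr => j _; rewrite -mulr_suml cost_dropE; ring.
Qed.

Definition serve_cost (r : request S k) x : R :=
  \sum_j req_cost r j * x (req_loc r) j.

Definition serve_slope (r : request S k) (p : page) : R :=
  if p.1 == req_loc r
  then req_cost r (widen_ord (leqnSn k) p.2) - req_cost r (lift ord0 p.2)
  else 0.

Lemma serve_costE r x : serve_cost r x =
  req_cost r ord_max * (\sum_j x (req_loc r) j) +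
  \sum_p serve_slope r p * level p x.
Proof.
rewrite /serve_cost sum_mul_cumul; congr (_ + _).
rewrite -(pair_bigA _ (fun i j => serve_slope r (i, j) * level (i, j) x))/=.
rewrite (bigD1 (req_loc r))//= [X in _ + X]big1 ?addr0 => [|i i_loc].
  by apply: eq_bigr => j _; rewrite /serve_slope eqxx.
by apply: big1 => j _; rewrite /serve_slope (negbTE i_loc) mul0r.
Qed.

Definition servers x : R := \sum_i \sum_(j < k.+1) (j : nat)%:R * x i j.

Lemma serversE x : servers x = \sum_p (\sum_j x p.1 j - level p x).
Proof.
rewrite -(pair_bigA _ (fun i j => \sum_j' x i j' - level (i, j) x))/=.
apply: eq_bigr => i _; rewrite (sum_mul_cumul (fun j => (j : nat)%:R)) /=.
rewrite sumrB sumr_const card_ord mulr_natl -sumrN; congr (_ + _).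
by apply: eq_bigr => j _; rewrite /level -natr1; ring.
Qed.

Lemma servers_is_linear : linear servers.
Proof.
move=> a x D; rewrite scaler_sumr -big_split/=; apply: eq_bigr => i _.
rewrite scaler_sumr -big_split/=; apply: eq_bigr => j _.
by rewrite !mxE mulrDr mulrCA.
Qed.

HB.instance Definition _ :=
  GRing.isLinear.Build R (state S k) R _ servers servers_is_linear.

End Levels.

Section FeasibleStates.
Variables (R : realType) (S : star R) (k q : nat).
Implicit Types (x y D : state S k) (i : 'I_(nloc S)).
Local Notation page := ('I_(nloc S) * 'I_k)%type.

Lemma cumul_homo x i j j' :
  is_state q x -> (j <= j')%N -> cumul x i j <= cumul x i j'.
Proof.
move=> [x_ge0 _ _] jj'; rewrite /cumul big_mkcond [leRHS]big_mkcond/=.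
apply: ler_sum => l _; case: ltnP => lj; first by rewrite (leq_trans lj).
by case: ifP.
Qed.

Lemma cumul_itv x i j : is_state q x -> 0 <= cumul x i j <= 1.
Proof.
move=> x_state; have [x_ge0 x_sum1 _] := x_state.
rewrite sumr_ge0//= -(x_sum1 i) /cumul big_mkcond/=.
by apply: ler_sum => l _; case: ifP.
Qed.

Lemma cumul_integral x i j : is_state q x -> integral_state x ->
  cumul x i j = 0 \/ cumul x i j = 1.
Proof.
move=> x_state x_int; have /natrP[n cumul_n] : cumul x i j \is a Num.nat.
  by apply: rpred_sum => l _; case: (x_int i l) => ->; rewrite ?rpred0 ?rpred1.
have := cumul_itv i j x_state; rewrite cumul_n lern1.
by case: n {cumul_n} => [|[|n]]//; rewrite ?andbF//; [left|right].
Qed.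

Lemma level_itv (p : page) x : is_state q x -> 0 <= level p x <= 1.
Proof. exact: cumul_itv. Qed.

Lemma servers_state x : is_state q x -> servers x = \sum_p (1 - level p x).
Proof.
by move=> [_ x_sum1 _]; rewrite serversE; under eq_bigr do rewrite x_sum1.
Qed.

Definition empty_state : state S k := \matrix_(_, j) (j == ord0)%:R.

Lemma empty_state_feasible : is_state q empty_state.
Proof.
split=> [i j|i|]; first by rewrite mxE.
  rewrite (bigD1 ord0)//= big1 ?addr0 => [|j /negbTE j_neq0];
    by rewrite mxE ?j_neq0.
rewrite big1// => i _; apply: big1 => -[[|j] jk] _;
  by rewrite mxE ?mul0r ?mulr0.
Qed.

Lemma empty_state_integral : integral_state empty_state.
Proof. by move=> i j; rewrite mxE; case: eqP; [right|left]. Qed.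

Definition feasible_direction x D : Prop :=
  \forall s \near 0^'+, is_state q (x + s *: D).

Lemma feasible_direction_tangent x D : is_state q x ->
  (forall i j, x i j = 0 -> 0 <= D i j) -> (forall i, \sum_j D i j = 0) ->
  (servers x = q%:R -> servers D <= 0) -> feasible_direction x D.
Proof.
move=> [x_ge0 x_sum1 x_quota] D_ge0 D_sum0 D_quota.
have entries : \forall s \near 0^'+, forall i j, 0 <= (x + s *: D) i j.
  apply: filter_forall => i; apply: filter_forall => j.
  have := x_ge0 i j; rewrite le_eqVlt => /predU1P[/esym x_eq0|x_gt0].
    by near=> s; rewrite !mxE x_eq0 add0r mulr_ge0 ?D_ge0.
  near=> s; rewrite !mxE; apply: ltW; near: s.
  exact: near_right_affine_gt0.
have quota : \forall s \near 0^'+, servers (x + s *: D) <= q%:R.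
  have := x_quota; rewrite -/(servers x) le_eqVlt => /predU1P[tight|slack].
    by near=> s; rewrite linearD linearZ/= tight gerDl mulr_ge0_le0 ?D_quota.
  near=> s; rewrite linearD linearZ/= -subr_ge0 opprD addrA -scalerN.
  by apply: ltW; near: s; apply: near_right_affine_gt0; rewrite subr_gt0.
near=> s; split.
- by near: s.
- move=> i; under eq_bigr do rewrite !mxE.
  by rewrite big_split -mulr_sumr/= x_sum1 D_sum0 mulr0 addr0.
- by near: s.
Unshelve. all: by end_near. Qed.

Lemma feasible_directionB x y :
  is_state q x -> is_state q y -> feasible_direction x (y - x).
Proof.
move=> x_state [y_ge0 y_sum1 y_quota].
have [_ x_sum1 _] := x_state.
apply: feasible_direction_tangent => // [i j x_eq0|i|tight].
- by rewrite !mxE x_eq0 subr0.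
- by under eq_bigr do rewrite !mxE; rewrite sumrB y_sum1 x_sum1 subrr.
- by rewrite linearB/= tight subr_le0.
Qed.

Lemma is_state_closed : closed [set x : state S k | is_state q x].
Proof.
have -> : [set x : state S k | is_state q x] =
    [set x : state S k | forall i j, 0 <= x i j] `&`
    [set x : state S k | forall i, \sum_j x i j = 1] `&`
    [set x : state S k | servers x <= q%:R].
  by apply/seteqP; split=> [x []|x [[]]].
apply: closedI; first apply: closedI.
- apply: closed_forall => i; apply: closed_forall => j.
  apply: (continuous_closedP _).1 (@closed_ge R 0); exact: coord_continuous.
- apply: closed_forall => i.
  apply: (continuous_closedP _).1 (@closed_eq R 1) => x.
  by apply: continuous_at_sum => j _; exact: coord_continuous.
- apply: (continuous_closedP _).1 (@closed_le R q%:R).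
  exact: mx_linear_continuous.
Qed.

Lemma is_state_compact : compact [set x : state S k | is_state q x].
Proof.
have entries_compact := @segment_compact R 0 1.
apply: subclosed_compact is_state_closed (mx_compact entries_compact) _.
move=> x [x_ge0 x_sum1 _] i j; rewrite /= in_itv/= x_ge0 -(x_sum1 i).
by rewrite (bigD1 j)//= lerDl sumr_ge0.
Qed.

End FeasibleStates.

(** * The transfer direction *)

Section Transfer.
Variables (R : realType) (d : R).
Hypothesis d_gt0 : 0 < d.
Implicit Types x y z : R.

(* The rate of change of a level in the direction that tests the optimality of a
   step from [x] to [z] against an integral [y]: raised levels decay at rate
   [z + d], unless [y] and [z] both saturate them, and the levels that only [y]
   saturates grow at rate 3, which is enough to respect the quota. *)
Definition transfer y x z : R :=
  3 * ((y == 1) && (z != 1))%:R -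
  ((x < z) && ~~ ((y == 1) && (z == 1)))%:R * (z + d).

Lemma transfer0 : transfer 0 0 0 = 0.
Proof. by rewrite /transfer (eq_sym 0) oner_eq0 ltxx /=; ring. Qed.

Lemma transfer1 : transfer 1 1 1 = 0.
Proof. by rewrite /transfer eqxx ltxx /=; ring. Qed.

Lemma transfer_homo x x' y y' z : 0 <= z -> x <= x' -> y <= y' -> y' <= 1 ->
  transfer y x z <= transfer y' x' z.
Proof.
move=> z_ge0 xx' yy' y'_le1.
have y_one : (y == 1) ==> (y' == 1).
  by apply/implyP => /eqP y_eq1; rewrite eq_le y'_le1 -y_eq1.
have raised : (x' < z) ==> (x < z) by apply/implyP; exact: le_lt_trans.
have zd_ge0 : 0 <= z + d by rewrite addr_ge0// ltW.
rewrite /transfer; case: (y == 1) (y' == 1) y_one => [] [] // _;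
  case: (x < z) (x' < z) raised => [] [] // _; case: (z == 1) => /=; lra.
Qed.

Lemma upward_move_le_transfer (w slope x y z : R) : d <= 1 -> 0 <= w ->
  0 <= x <= 1 -> 0 <= z <= 1 -> y = 0 \/ y = 1 ->
  w * (ln (z + d) - ln (x + d)) <= slope ->
  w * Num.max 0 (z - x) <= (3 * y - transfer y x z) * slope.
Proof.
move=> d_le1 w_ge0 /andP[x_ge0 x_le1] /andP[z_ge0 z_le1] y_binary slope_ge.
have -> : 3 * y - transfer y x z =
    3 * ((y == 1) && (z == 1))%:R +
    ((x < z) && ~~ ((y == 1) && (z == 1)))%:R * (z + d).
  rewrite /transfer; case: y_binary => ->.
    by rewrite (eq_sym 0) oner_eq0 /=; ring.
  by rewrite eqxx; case: (z == 1) => /=; ring.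
have [zx|xz] := leP z x.
  rewrite max_l ?subr_le0// mulr0 mul0r addr0.
  have [/andP[_ /eqP z_eq1]|_] := boolP (_ && _); last by rewrite mulr0 mul0r.
  have x_eq1 : x = 1 by apply/le_anti; rewrite x_le1 -z_eq1.
  by move: slope_ge; rewrite z_eq1 x_eq1 subrr mulr0 /=; lra.
rewrite max_r ?subr_ge0 ?(ltW xz)//.
have xd_gt0 : 0 < x + d by rewrite ltr_wpDl.
have zd_gt0 : 0 < z + d by rewrite ltr_wpDl.
have slope_ge0 : 0 <= slope.
  by apply: le_trans slope_ge; rewrite mulr_ge0// subr_ge0 ler_lnD// ltW.
have gain : w * (z - x) <= (z + d) * slope.
  have := ler_wpM2l w_ge0 (subr_le_mul_lnB zd_gt0 xd_gt0).
  have := ler_wpM2l (ltW zd_gt0) slope_ge; lra.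
case: (_ && _) => /=; last by rewrite mulr0 add0r mul1r.
have : (z + d) * slope <= 3 * slope by apply: ler_wpM2r => //; lra.
by rewrite mul0r addr0; lra.
Qed.

Section TransferSum.
Variables (F : finType) (x y z : F -> R) (q : R).
Hypotheses (d_le1 : d <= 1) (dq_le1 : d * q <= 1).
Hypotheses (x_ge0 : forall f, 0 <= x f) (z_ge0 : forall f, 0 <= z f).
Hypothesis y_binary : forall f, y f = 0 \/ y f = 1.
Hypotheses (y_quota : \sum_f (1 - y f) <= q) (z_quota : \sum_f (1 - z f) = q).

Definition saturated f := (y f == 1) && (z f == 1).
Definition lag : R := \sum_f ((y f == 1) && (z f != 1))%:R.

Lemma unsaturated_mass_le : \sum_f (~~ saturated f)%:R * z f <= lag.
Proof.
suff -> : \sum_f (~~ saturated f)%:R * z f =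
    lag + \sum_f (1 - y f) - \sum_f (1 - z f)
  by move: y_quota; rewrite z_quota; lra.
rewrite -big_split -sumrB/=; apply: eq_bigr => f _.
rewrite /saturated; case: (y_binary f) => ->.
  by rewrite eq_sym oner_eq0 /=; ring.
by rewrite eqxx; case: eqP => [->|_] /=; ring.
Qed.

Lemma unsaturated_count_le : \sum_f (~~ saturated f)%:R <= q + lag.
Proof.
apply: le_trans (lerD (lexx q) unsaturated_mass_le).
rewrite -z_quota -big_split; apply: ler_sum => f _; rewrite /saturated.
by have [/andP[_ /eqP ->]|_] := boolP (_ && _); rewrite /=; lra.
Qed.

Lemma lag_eq0_or_ge1 : lag = 0 \/ 1 <= lag.
Proof.
rewrite /lag -natr_sum; case: (\sum_f _)%N => [|n]; first by left.
by right; rewrite ler1n.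
Qed.

Lemma unsaturated_eq0 f : lag = 0 -> ~~ saturated f -> z f = 0.
Proof.
move=> lag_eq0 f_unsaturated.
have mass_ge0 g : 0 <= (~~ saturated g)%:R * z g by rewrite mulr_ge0.
have /psumr_eq0P mass_eq0 : \sum_g (~~ saturated g)%:R * z g = 0.
  by apply/le_anti; rewrite (le_trans unsaturated_mass_le) ?lag_eq0// sumr_ge0.
have := mass_eq0 (fun g _ => mass_ge0 g) f isT.
by rewrite f_unsaturated mul1r.
Qed.

Lemma sum_transfer_ge0 : 0 <= \sum_f transfer (y f) (x f) (z f).
Proof.
(* A positive [lag] is large enough to absorb the shifts [d]. *)
have [lag_eq0|lag_ge1] := lag_eq0_or_ge1.
  apply: sumr_ge0 => f _; rewrite /transfer subr_ge0.
  have [/andP[x_lt_z]|_] := boolP (_ && _); last by rewrite mul0r mulr_ge0.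
  move=> /(unsaturated_eq0 lag_eq0) z_eq0; move: x_lt_z.
  by rewrite z_eq0 ltNge x_ge0.
apply: (@le_trans _ _ (\sum_f (3 * ((y f == 1) && (z f != 1))%:R -
    ((~~ saturated f)%:R * z f + d * (~~ saturated f)%:R)))).
  rewrite sumrB -mulr_sumr -/lag big_split/= -mulr_sumr.
  have := unsaturated_mass_le.
  have := ler_wpM2l (ltW d_gt0) unsaturated_count_le.
  have := ler_wpM2r (le_trans ler01 lag_ge1) d_le1.
  by move: dq_le1; lra.
apply: ler_sum => f _; rewrite /transfer lerD2l lerN2 -/(saturated f).
by case: (x f < z f) (saturated f) => [] []; move: (z_ge0 f) d_gt0 => /=; lra.
Qed.

End TransferSum.
End Transfer.

(** * Potentials *)

Lemma weight_ge0 (R : realType) (S : star R) (i : 'I_(nloc S)) : 0 <= weight i.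
Proof. exact: ltW (weight_gt0 i). Qed.

Section Movement.
Variables (R : realType) (S : star R) (k : nat).
Implicit Types x y : state S k.
Local Notation page := ('I_(nloc S) * 'I_k)%type.

Lemma moveE x y : move x y = \sum_p weight p.1 * `|level p y - level p x|.
Proof.
rewrite -(pair_bigA _
  (fun i j => weight i * `|level (i, j) y - level (i, j) x|))/=.
by apply: eq_bigr => i _; rewrite big_add1 big_mkord mulr_sumr.
Qed.

Lemma move_ge0 x y : 0 <= move x y.
Proof. by rewrite moveE sumr_ge0// => p _; rewrite mulr_ge0 ?weight_ge0. Qed.

Definition total_level x : R := \sum_(p : page) weight p.1 * level p x.

Definition move_up x y : R :=
  \sum_(p : page) weight p.1 * Num.max 0 (level p y - level p x).

Lemma move_up_ge0 x y : 0 <= move_up x y.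
Proof.
by rewrite sumr_ge0// => p _; rewrite mulr_ge0 ?weight_ge0// le_max lexx.
Qed.

Lemma move_total_level x y :
  move x y = 2 * move_up x y + total_level x - total_level y.
Proof.
rewrite moveE mulr_sumr -big_split -sumrB/=; apply: eq_bigr => p _.
by case: leP => level_cmp; [rewrite ger0_norm//|rewrite ltr0_norm//]; ring.
Qed.

End Movement.

Section Potentials.
Variables (R : realType) (S : star R) (k : nat) (d : R).
Hypothesis d_gt0 : 0 < d.
Implicit Types x y z : state S k.
Local Notation page := ('I_(nloc S) * 'I_k)%type.

Lemma level_shift_gt0 q p x : is_state q x -> 0 < level p x + d.
Proof. by move=> /(level_itv p)/andP[x_ge0 _]; rewrite ltr_wpDl. Qed.

Definition divergence y x : R :=
  \sum_(p : page) weight p.1 * rel_entropy (level p y + d) (level p x + d).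

Lemma divergencexx x : divergence x x = 0.
Proof. by apply: big1 => p _; rewrite rel_entropyxx mulr0. Qed.

Lemma divergence_ge0 q q' y x :
  is_state q y -> is_state q' x -> 0 <= divergence y x.
Proof.
move=> y_state x_state; apply: sumr_ge0 => p _.
rewrite mulr_ge0 ?weight_ge0// rel_entropy_ge0//.
- exact: level_shift_gt0 y_state.
- exact: level_shift_gt0 x_state.
Qed.

Lemma divergence_three_point y z x : divergence y x =
  divergence y z + divergence z x +
  \sum_p weight p.1 * (ln (level p z + d) - ln (level p x + d)) *
         (level p y - level p z).
Proof.
rewrite -!big_split/=; apply: eq_bigr => p _.
by rewrite (rel_entropy_three_point _ _ (level p z + d)); ring.
Qed.

Lemma divergence_le_chi2 q q' y x : is_state q y -> is_state q' x ->
  divergence y x <=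
  \sum_p weight p.1 * ((level p y - level p x) ^+ 2 / (level p x + d)).
Proof.
move=> y_state x_state; apply: ler_sum => p _; rewrite ler_wpM2l ?weight_ge0//.
have -> : level p y - level p x = level p y + d - (level p x + d) by ring.
apply: rel_entropy_le_chi2; first exact: level_shift_gt0 y_state.
exact: level_shift_gt0 x_state.
Qed.

Lemma divergence_lipschitz q q' q'' y y' x :
  is_state q y -> is_state q' y' -> is_state q'' x ->
  divergence y' x <= divergence y x + log_range d * move y y'.
Proof.
move=> y_state y'_state x_state; rewrite moveE mulr_sumr -big_split/=.
apply: ler_sum => p _; rewrite mulrCA -mulrDr ler_wpM2l ?weight_ge0//.
apply: rel_entropyD_lipschitz => //.
- exact: level_itv y_state.
- exact: level_itv y'_state.
- exact: level_itv x_state.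
Qed.

Lemma continuous_at_divergence q q' x y : is_state q x -> is_state q' y ->
  {for y, continuous (fun z => divergence z x)}.
Proof.
move=> x_state y_state; apply: continuous_at_sum => p _.
have level_cts : {for y, continuous (fun z => level p z + d)}.
  by apply: continuousD; [exact: level_continuous|exact: cst_continuous].
apply: continuousM; first exact: cst_continuous.
apply: continuousD; last exact: cst_continuous.
apply: continuousB => //; apply: continuousM => //.
apply: continuousB; last exact: cst_continuous.
apply: (continuous_comp level_cts); apply: continuous_ln.
exact: level_shift_gt0 y_state.
Qed.

Definition log_deficit y x : R := \sum_(p : page)
  weight p.1 * (level p y * (ln (1 + d) - ln (level p x + d))).

Lemma log_deficit_ge0 q q' y x :
  is_state q y -> is_state q' x -> 0 <= log_deficit y x.
Proof.
move=> y_state x_state; apply: sumr_ge0 => p _.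
have /andP[y_ge0 _] := level_itv p y_state.
have /andP[x_ge0 x_le1] := level_itv p x_state.
by rewrite !mulr_ge0 ?weight_ge0// subr_ge0 ler_lnD.
Qed.

Lemma log_deficitxx q y :
  is_state q y -> integral_state y -> log_deficit y y = 0.
Proof.
move=> y_state y_int; apply: big1 => p _.
have [] := cumul_integral p.1 p.2.+1 y_state y_int; rewrite /level => ->.
  by rewrite mul0r mulr0.
by rewrite subrr !mulr0.
Qed.

Lemma log_deficit_lipschitz q y y' x : is_state q x ->
  log_deficit y' x <= log_deficit y x + log_range d * move y y'.
Proof.
move=> x_state; rewrite moveE mulr_sumr -big_split/=; apply: ler_sum => p _.
rewrite [log_range d * _]mulrCA -mulrDr ler_wpM2l ?weight_ge0//.
rewrite -lerBlDl -mulrBl mulrC.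
apply: le_trans (ler_norm _) _; rewrite normrM ler_wpM2r//.
by apply: ler_norm_lnDB => //; [rewrite ler01 lexx|exact: level_itv x_state].
Qed.

Lemma total_levelB_le q q' y x : d <= 1 -> is_state q y -> is_state q' x ->
  total_level y - total_level x <= 2 * log_deficit y x.
Proof.
move=> d_le1 y_state x_state; rewrite mulr_sumr -sumrB; apply: ler_sum => p _.
rewrite -mulrBr mulrCA ler_wpM2l ?weight_ge0//.
apply: subr_le_mul_ln_deficit => //; first exact: level_itv y_state.
exact: level_itv x_state.
Qed.

End Potentials.

(** * The proximal step *)

Section ProximalStep.
Variables (R : realType) (S : star R) (k : nat) (d : R) (r : request S k).
Hypothesis d_gt0 : 0 < d.
Implicit Types x y z D : state S k.
Local Notation page := ('I_(nloc S) * 'I_k)%type.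

Definition prox_objective x y : R :=
  log_range d * serve_cost r y + divergence d y x.

Definition is_prox_step x z : Prop :=
  is_state (req_quota r) z /\
  forall y, is_state (req_quota r) y ->
    prox_objective x z <= prox_objective x y.

Lemma continuous_at_prox_objective q q' x y : is_state q x -> is_state q' y ->
  {for y, continuous (prox_objective x)}.
Proof.
move=> x_state y_state.
apply: continuousD; last exact: continuous_at_divergence x_state y_state.
apply: continuousM; first exact: cst_continuous.
apply: continuous_at_sum => j _; apply: continuousM.
  exact: cst_continuous.
exact: coord_continuous.
Qed.

Lemma prox_step_exists q x : is_state q x -> exists z, is_prox_step x z.
Proof.
move=> x_state; have [||y|z] := @compact_EVT_min (state S k) R
    (prox_objective x) [set y | is_state (req_quota r) y].
- by exists (empty_state S k); exact: empty_state_feasible.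
- exact: is_state_compact.
- apply: continuous_in_subspaceT => {}y /set_mem y_state.
  exact: continuous_at_prox_objective x_state y_state.
rewrite inE => z_state z_min; exists z; split=> // y y_state.
by apply: z_min; rewrite inE.
Qed.

Section Optimality.
Variables (q : nat) (x z : state S k).
Hypotheses (x_state : is_state q x) (z_prox : is_prox_step x z).

Let z_state : is_state (req_quota r) z. Proof. by case: z_prox. Qed.

Definition prox_gradient (p : page) : R := log_range d * serve_slope r p +
  weight p.1 * (ln (level p z + d) - ln (level p x + d)).

Lemma prox_objective_three_point q' y : is_state q' y ->
  prox_objective x y = prox_objective x z +
    \sum_p prox_gradient p * (level p y - level p z) + divergence d y z.
Proof.
move=> [_ y_sum1 _]; have [_ z_sum1 _] := z_state.
rewrite /prox_objective !serve_costE y_sum1 z_sum1.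
rewrite (divergence_three_point d y z x).
have -> : \sum_p prox_gradient p * (level p y - level p z) =
    log_range d * (\sum_p serve_slope r p * level p y -
                   \sum_p serve_slope r p * level p z) +
    \sum_p weight p.1 * (ln (level p z + d) - ln (level p x + d)) *
           (level p y - level p z).
  by rewrite -sumrB mulr_sumr -big_split; apply: eq_bigr => p _;
     rewrite /prox_gradient/=; ring.
by ring.
Qed.

Lemma prox_gradient_feasible_ge0 D : feasible_direction (req_quota r) z D ->
  0 <= \sum_p prox_gradient p * level p D.
Proof.
move=> D_feasible; rewrite leNgt; apply/negP => slope_lt0.
pose curvature := \sum_p weight p.1 * (level p D ^+ 2 / (level p z + d)).
have [s [s_gt0 zD_state small]] : exists s : R,
    [/\ 0 < s, is_state (req_quota r) (z + s *: D) &
        0 < - (\sum_p prox_gradient p * level p D) + s * - curvature].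
  apply: (@filter_ex _ (0 : R)^'+); near=> s; split; near: s.
  - exact: nbhs_right_gt.
  - exact: D_feasible.
  - by apply: near_right_affine_gt0; rewrite oppr_gt0.
have levelB p : level p (z + s *: D) - level p z = s * level p D.
  by rewrite linearD linearZ/= addrC addKr.
have objective_le : prox_objective x (z + s *: D) <= prox_objective x z +
    s * (\sum_p prox_gradient p * level p D + s * curvature).
  rewrite (prox_objective_three_point zD_state) -addrA lerD2l mulrDr.
  apply: lerD.
    by rewrite mulr_sumr; apply: ler_sum => p _; rewrite levelB mulrCA.
  apply: le_trans (divergence_le_chi2 d_gt0 zD_state z_state) _.
  rewrite /curvature !mulr_sumr; apply: ler_sum => p _; rewrite levelB exprMn.
  by rewrite le_eqVlt; apply/orP; left; apply/eqP; ring.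
have := le_trans (z_prox.2 _ zD_state) objective_le.
by rewrite lerDl pmulr_rge0//; lra.
Unshelve. all: by end_near. Qed.

Lemma divergence_prox_step y : is_state (req_quota r) y ->
  divergence d y z + log_range d * serve_cost r z <=
  divergence d y x + log_range d * serve_cost r y.
Proof.
move=> y_state.
have := prox_gradient_feasible_ge0 (feasible_directionB z_state y_state).
under eq_bigr do rewrite linearB/=.
have := prox_objective_three_point y_state.
have := divergence_ge0 d_gt0 z_state x_state.
rewrite /prox_objective; lra.
Qed.

End Optimality.
End ProximalStep.

Definition valid_request (R : realType) (S : star R) (k : nat)
    (r : request S k) : Prop :=
  [/\ (req_quota r <= k)%N, forall j, 0 <= req_cost r j &
      forall j j' : 'I_k.+1, (j <= j')%N -> req_cost r j' <= req_cost r j].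

Section UpwardMovement.
Variables (R : realType) (S : star R) (k : nat) (d : R) (r : request S k).
Variables (q : nat) (x y z : state S k).
Hypotheses (d_gt0 : 0 < d) (dk_le1 : d * k%:R <= 1) (d_le1 : d <= 1).
Hypothesis r_valid : valid_request r.
Hypotheses (x_state : is_state q x) (z_prox : is_prox_step d r x z).
Hypotheses (y_state : is_state (req_quota r) y) (y_int : integral_state y).
Local Notation page := ('I_(nloc S) * 'I_k)%type.

Let z_state : is_state (req_quota r) z. Proof. by case: z_prox. Qed.

Lemma serve_slope_ge0 (p : page) : 0 <= serve_slope r p.
Proof.
have [_ _ cost_homo] := r_valid.
by rewrite /serve_slope; case: ifP => // _; rewrite subr_ge0 cost_homo /=.
Qed.

Definition transfer_direction : state S k := of_cumul k (fun i j =>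
  transfer d (cumul y i j) (cumul x i j) (cumul z i j)).

Lemma cumul_transfer_direction i j : (j <= k.+1)%N ->
  cumul transfer_direction i j =
  transfer d (cumul y i j) (cumul x i j) (cumul z i j).
Proof. by move=> jk; rewrite cumul_of_cumul// !cumul0 transfer0 subr0. Qed.

Lemma level_transfer_direction (p : page) : level p transfer_direction =
  transfer d (level p y) (level p x) (level p z).
Proof. by rewrite [LHS]cumul_transfer_direction// ltnS ltnW. Qed.

Lemma transfer_direction_feasible :
  feasible_direction (req_quota r) z transfer_direction.
Proof.
have row0 i : \sum_j transfer_direction i j = 0.
  rewrite -cumul_all cumul_transfer_direction// !cumul_all.
  have [[[_ -> _] [_ -> _]] [_ -> _]] := (x_state, y_state, z_state).
  exact: transfer1.
apply: feasible_direction_tangent => // [i j z_eq0|tight].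
  rewrite mxE subr_ge0 (cumulS z) z_eq0 addr0; apply: transfer_homo => //.
  - by case/andP: (cumul_itv i j z_state).
  - exact: cumul_homo x_state (leqnSn j).
  - exact: cumul_homo y_state (leqnSn j).
  - by case/andP: (cumul_itv i j.+1 y_state).
rewrite serversE; under eq_bigr do rewrite row0 level_transfer_direction sub0r.
have [quota_le_k _ _] := r_valid.
rewrite sumrN oppr_le0.
apply: (sum_transfer_ge0 d_gt0 d_le1 (q := (req_quota r)%:R)) => //.
- by apply: le_trans dk_le1; rewrite ler_pM2l// ler_nat.
- by move=> p; case/andP: (level_itv p x_state).
- by move=> p; case/andP: (level_itv p z_state).
- by move=> p; exact: cumul_integral y_state y_int.
- by rewrite -(servers_state y_state); case: y_state.
- by rewrite -(servers_state z_state).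
Qed.

Lemma move_up_le_gradient :
  move_up x z <= 3 * \sum_p level p y * prox_gradient d r x z p.
Proof.
apply: (@le_trans _ _ (\sum_p (3 * level p y -
    transfer d (level p y) (level p x) (level p z)) * prox_gradient d r x z p)).
  apply: ler_sum => p _; apply: upward_move_le_transfer => //.
  - exact: weight_ge0.
  - exact: level_itv x_state.
  - exact: level_itv z_state.
  - exact: cumul_integral y_state y_int.
  - rewrite lerDr mulr_ge0 ?serve_slope_ge0//.
    exact: ltW (log_range_gt0 d_gt0).
suff -> : \sum_p (3 * level p y -
        transfer d (level p y) (level p x) (level p z)) *
      prox_gradient d r x z p =
    3 * (\sum_p level p y * prox_gradient d r x z p) -
      \sum_p prox_gradient d r x z p * level p transfer_direction.
  rewrite gerBl; exact: prox_gradient_feasible_ge0 transfer_direction_feasible.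
rewrite mulr_sumr -sumrB; apply: eq_bigr => p _.
by rewrite level_transfer_direction; ring.
Qed.

Lemma log_deficit_prox_step : log_deficit d y z + move_up x z / 3 <=
  log_deficit d y x + log_range d * serve_cost r y.
Proof.
have slope_le : \sum_p serve_slope r p * level p y <= serve_cost r y.
  have [[_ y_sum1 _] [_ cost_ge0 _]] := (y_state, r_valid).
  by rewrite serve_costE y_sum1 mulr1 lerDr.
have gradientE : \sum_p level p y * prox_gradient d r x z p =
    log_deficit d y x - log_deficit d y z +
    log_range d * \sum_p serve_slope r p * level p y.
  rewrite mulr_sumr -sumrB -big_split; apply: eq_bigr => p _.
  by rewrite /prox_gradient/=; ring.
have := move_up_le_gradient; rewrite gradientE.
have := ler_wpM2l (ltW (log_range_gt0 d_gt0)) slope_le; lra.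
Qed.

End UpwardMovement.

(** * Competitive analysis *)

Definition request_at (R : realType) (S : star R) (k : nat) (I : instance S k)
  (t : nat) : request S k := Request (kappa I t) (loc I t) (hcost I t).

Lemma valid_request_at (R : realType) (S : star R) (k : nat)
    (I : instance S k) (t : nat) :
  valid_instance I -> (0 < t)%N -> valid_request (request_at I t).
Proof.
move=> [quota_le cost_valid _ _] t_gt0.
have [cost_ge0 cost_homo] := cost_valid t t_gt0.
by split=> //; exact: quota_le.
Qed.

Section Amortization.
Variables (R : realType) (S : star R) (k : nat) (I : instance S k).
Implicit Types x y : nat -> state S k.

Lemma hitS T y :
  hit I T.+1 y = hit I T y + serve_cost (request_at I T.+1) (y T.+1).
Proof. by rewrite /hit big_nat_recr. Qed.

Lemma movS T y : mov T.+1 y = mov T y + move (y T) (y T.+1).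
Proof. by rewrite /mov big_nat_recr. Qed.

Lemma mov_ge0 T y : 0 <= mov T y.
Proof. by apply: sumr_ge0 => t _; exact: move_ge0. Qed.

Lemma mov_total_level T y : mov T y =
  2 * (\sum_(1 <= t < T.+1) move_up (y t.-1) (y t)) + total_level (y 0%N) -
  total_level (y T).
Proof.
elim: T => [|T IHT]; first by rewrite /mov !big_nil mulr0 add0r subrr.
by rewrite movS IHT [in RHS]big_nat_recr//= move_total_level; ring.
Qed.

Lemma total_levelB_le_mov T y :
  total_level (y 0%N) - total_level (y T) <= mov T y.
Proof.
rewrite mov_total_level -addrA lerDr mulr_ge0// sumr_ge0// => t _.
exact: move_up_ge0.
Qed.

Lemma hit_ge0 T y : valid_instance I -> solution I T y -> 0 <= hit I T y.
Proof.
move=> I_valid [_ y_state]; rewrite /hit big_nat; apply: sumr_ge0 => t t_le.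
have [y_ge0 _ _] := y_state t t_le; have /andP[t_gt0 _] := t_le.
have [_ cost_ge0 _] := valid_request_at I_valid t_gt0.
by apply: sumr_ge0 => j _; apply: mulr_ge0; [exact: cost_ge0|exact: y_ge0].
Qed.

Lemma amortized_cost_le (a : R) (pot : state S k -> state S k -> R)
    (gain : nat -> R) T x y :
  pot (y 0%N) (x 0%N) <= 0 ->
  (forall t, (t < T)%N ->
    pot (y t.+1) (x t) <= pot (y t) (x t) + a * move (y t) (y t.+1)) ->
  (forall t, (t < T)%N -> pot (y t.+1) (x t.+1) + gain t.+1 <=
    pot (y t.+1) (x t) + a * serve_cost (request_at I t.+1) (y t.+1)) ->
  pot (y T) (x T) + \sum_(1 <= t < T.+1) gain t <= a * (hit I T y + mov T y).
Proof.
move=> pot_start; elim: T => [|T IHT] pot_move pot_step.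
  by rewrite /hit /mov !big_nil !addr0 mulr0.
rewrite hitS movS big_nat_recr//=.
have := IHT (fun t tT => pot_move t (ltnW tT))
  (fun t tT => pot_step t (ltnW tT)).
have := pot_move T (ltnSn T); have := pot_step T (ltnSn T).
lra.
Qed.

End Amortization.

Definition prox_step (R : realType) (S : star R) (k : nat) (d : R)
  (x : state S k) (r : request S k) : state S k := xget x (is_prox_step d r x).

Lemma prox_stepP (R : realType) (S : star R) (k q : nat) (d : R) (x : state S k)
    (r : request S k) :
  0 < d -> is_state q x -> is_prox_step d r x (prox_step d x r).
Proof.
by move=> d_gt0 x_state; exact: xgetPex (prox_step_exists r d_gt0 x_state).
Qed.

Definition prox_algorithm (R : realType) : online_algorithm R :=
  fun S k x _ rs => foldl (@prox_step R S k k.+1%:R^-1) x rs.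

Section Competitiveness.
Variables (R : realType) (S : star R) (k : nat) (I : instance S k).
Hypothesis I_valid : valid_instance I.
Local Notation d := (k.+1%:R^-1 : R).
Local Notation alg := (run (@prox_algorithm R) I).

Let d_gt0 : 0 < d. Proof. by rewrite invr_gt0 ltr0n. Qed.
Let d_le1 : d <= 1. Proof. by rewrite invf_le1 ?ltr0n// ler1n. Qed.
Let dk_le1 : d * k%:R <= 1.
Proof. by rewrite mulrC ler_pdivrMr ?ltr0n// mul1r ler_nat. Qed.

Lemma log_range_prox_le : (0 < k)%N -> log_range d <= 2 * ln (1 + k%:R).
Proof.
move=> k_gt0; have k_ge1 : 1 <= k%:R :> R by rewrite ler1n.
have base_gt0 : 0 < 1 + k%:R :> R by lra.
rewrite /log_range invrK mulr_natl -lnXn// ler_ln ?posrE ?exprn_gt0//.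
by rewrite -natr1; nra.
Qed.

Lemma run_proxS t : alg t.+1 = prox_step d (alg t) (request_at I t.+1).
Proof.
have runE s : alg s = foldl (prox_step d) (start I) (history I s) by case: s.
by rewrite !runE /history -[t.+1]addn1 iotaD map_cat foldl_cat/= add1n addn1.
Qed.

Lemma run_prox_state t : is_state (kappa I t) (alg t).
Proof.
elim: t => [|t x_state]; first by case: I_valid.
by rewrite run_proxS; have [] := prox_stepP (request_at I t.+1) d_gt0 x_state.
Qed.

Lemma run_is_prox_step t :
  is_prox_step d (request_at I t.+1) (alg t) (alg t.+1).
Proof. by rewrite run_proxS; exact: prox_stepP d_gt0 (run_prox_state t). Qed.

Section Comparison.
Variables (T : nat) (y : nat -> state S k).
Hypotheses (y_sol : solution I T y).
Hypothesis y_int : forall t, (t <= T)%N -> integral_state (y t).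

Let y_start : y 0%N = start I. Proof. by case: y_sol. Qed.

Let y_state t : (t <= T)%N -> is_state (kappa I t) (y t).
Proof.
case: t => [_|t tT]; first by rewrite y_start; case: I_valid.
by case: y_sol => _; exact.
Qed.

Lemma hit_prox_le_cost : hit I T alg <= hit I T y + mov T y.
Proof.
have amortized : divergence d (y T) (alg T) +
    \sum_(1 <= t < T.+1) log_range d * serve_cost (request_at I t) (alg t) <=
    log_range d * (hit I T y + mov T y).
  apply: amortized_cost_le => [|t tT|t tT].
  - by rewrite y_start divergencexx.
  - exact: (divergence_lipschitz d_gt0 (y_state (ltnW tT)) (y_state tT)
      (run_prox_state t)).
  - exact: (divergence_prox_step d_gt0 (run_prox_state t) (run_is_prox_step t)
      (y_state tT)).
rewrite -(ler_pM2l (log_range_gt0 d_gt0)); apply: le_trans amortized.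
rewrite -mulr_sumr lerDr.
exact: (divergence_ge0 d_gt0 (y_state (leqnn T)) (run_prox_state T)).
Qed.

Lemma mov_prox_le_cost : mov T alg <= 8 * log_range d * (hit I T y + mov T y).
Proof.
have cost_ge0 : 0 <= hit I T y + mov T y by rewrite addr_ge0 ?hit_ge0 ?mov_ge0.
have up_le : log_deficit d (y T) (alg T) +
    \sum_(1 <= t < T.+1) move_up (alg t.-1) (alg t) / 3 <=
    log_range d * (hit I T y + mov T y).
  apply: amortized_cost_le => [|t tT|t tT].
  - rewrite /= -y_start.
    by rewrite (log_deficitxx d (y_state (leq0n T)) (y_int (leq0n T))).
  - exact: (log_deficit_lipschitz d_gt0 _ _ (run_prox_state t)).
  - apply: log_deficit_prox_step => //.
    + exact: valid_request_at.
    + exact: run_prox_state.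
    + exact: run_is_prox_step.
    + exact: y_state.
    + exact: y_int.
have := total_levelB_le d_gt0 d_le1 (y_state (leqnn T)) (run_prox_state T).
have := log_deficit_ge0 d_gt0 (y_state (leqnn T)) (run_prox_state T).
have := total_levelB_le_mov T y; rewrite y_start.
have := ler_wpM2r cost_ge0 (log_range_ge_half d_gt0 d_le1).
move: up_le; rewrite -mulr_suml (mov_total_level T alg) /=.
have := hit_ge0 I_valid y_sol; lra.
Qed.

End Comparison.

Lemma integral_solution_exists T : exists y : nat -> state S k,
  solution I T y /\ forall t, (t <= T)%N -> integral_state (y t).
Proof.
have [_ _ _ start_int] := I_valid.
exists (fun t => if t is 0 then start I else empty_state S k); split.
  by split=> // -[|t] // _; exact: empty_state_feasible.
by case=> // t _; exact: empty_state_integral.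
Qed.

Lemma le_opt T (a : R) :
  (forall y, solution I T y -> (forall t, (t <= T)%N -> integral_state (y t)) ->
    a <= hit I T y + mov T y) -> a <= opt I T.
Proof.
move=> a_le; apply: lb_le_inf => [|_ [y [y_sol y_int ->]]]; last exact: a_le.
have [y [y_sol y_int]] := integral_solution_exists T.
by exists (hit I T y + mov T y), y.
Qed.

Lemma opt_ge0 T : 0 <= opt I T.
Proof. by apply: le_opt => y y_sol _; rewrite addr_ge0 ?hit_ge0 ?mov_ge0. Qed.

Lemma hit_prox_le_opt T : hit I T alg <= opt I T.
Proof. by apply: le_opt => y y_sol y_int; exact: hit_prox_le_cost. Qed.

Lemma mov_prox_le_opt T : mov T alg <= 16 * ln (1 + k%:R) * opt I T.
Proof.
case: (posnP k) => [k_eq0|k_gt0].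
  rewrite [leLHS]big1 => [|t _].
    by rewrite !mulr_ge0 ?opt_ge0// ln_ge0// lerDl.
  rewrite moveE; apply: big1 => -[i [j j_lt_k]] _.
  by exfalso; rewrite k_eq0 in j_lt_k.
have ln_gt0 : 0 < ln (1 + k%:R) :> R by rewrite ln_gt0// ltrDl ltr0n.
have range_le := log_range_prox_le k_gt0.
rewrite -ler_pdivrMl; last by rewrite mulr_gt0.
apply: le_opt => y y_sol y_int; rewrite ler_pdivrMl ?mulr_gt0//.
apply: le_trans (mov_prox_le_cost y_sol y_int) _; apply: ler_wpM2r; last by lra.
by rewrite addr_ge0 ?hit_ge0 ?mov_ge0.
Qed.

End Competitiveness.

Lemma wmax_ge0 (R : realType) (S : star R) : 0 <= wmax S.
Proof. exact: bigmax_ge_id. Qed.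

Theorem theorem3p6 (R : realType) :
  exists c : R, forall eps : R, 0 < eps <= 1 ->
  exists (A : online_algorithm R)
         (C : forall (S : star R) (k : nat), state S k -> state S k -> R),
    (forall (S : star R) (k : nat) (x : state S k), C S k x x = 0) /\
    forall (S : star R) (k : nat) (I : instance S k), valid_instance I ->
    forall T : nat,
      [/\ solution I T (run A I),
          hit I T (run A I) <=
            (1 + eps) * (opt I T + wmax S * quota_var I T)
            + C S k (start I) (run A I T) &
          mov T (run A I) <=
            c * ln (1 + k%:R / eps) * (opt I T + wmax S * quota_var I T)].
Proof.
exists 16 => eps /andP[eps_gt0 eps_le1].
exists (@prox_algorithm R), (fun _ _ _ _ => 0); split=> // S k I I_valid T.
have quota_cost_ge0 : 0 <= wmax S * quota_var I T.
  by rewrite mulr_ge0 ?wmax_ge0// sumr_ge0.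
have opt_le : opt I T <= opt I T + wmax S * quota_var I T by rewrite lerDl.
have bound_ge0 := le_trans (opt_ge0 I_valid T) opt_le.
split.
- by split=> // t _; exact: run_prox_state.
- rewrite addr0.
  apply: le_trans (hit_prox_le_opt I_valid T) (le_trans opt_le _).
  by rewrite ler_peMl// lerDl ltW.
- apply: le_trans (mov_prox_le_opt I_valid T) _.
  apply: ler_pM => //; [by rewrite mulr_ge0// ln_ge0// lerDl|exact: opt_ge0|].
  rewrite ler_pM2l// ler_ln ?posrE ?ltr_pwDl ?divr_ge0 ?(ltW eps_gt0)//.
  by rewrite lerD2l ler_peMr// invf_ge1.
Qed.
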